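(* Let $\mu$ be a probability measure on $\mathbb{R}$. For $\beta\in[0,1]$ and $m>0$ the following conditions are equivalent. (i) There exists $\sigma\ge 0$ such that $\mu\in\mathcal{M}_\beta(m,\sigma^{\beta+1})$. (ii) For some $h>0$, $\alpha<1$ and all $x>m$, $$\mu([x+h/x^\beta,\infty))\le\alpha\,\mu([x,\infty)),\qquad \mu((-\infty,-x-h/x^\beta])\le\alpha\,\mu((-\infty,-x]).$$ Moreover, the constants in (i) depend only on the constants in (ii) and vice versa. For instance, if (i) holds, one can take $h=2\sigma^{\beta+1}$ and $\alpha=1/2$ in the inequalities of (ii).
   Context: For $\beta\in[0,1]$, $m>0$, $\sigma\ge 0$, $\mathcal{M}_\beta(m,\sigma^{\beta+1})$ denotes the class of probability measures $\mu$ on $\mathbb{R}$ such that $$\forall_{x\ge m}\ \ \nu^+([x,\infty))\le\sigma^{\beta+1}\mu([x,\infty)),\qquad \forall_{x\le -m}\ \ \nu^-((-\infty,x])\le\sigma^{\beta+1}\mu((-\infty,x]),$$ where $\nu^+$ is the measure on $[m,\infty)$ with (Lebesgue) density $x^\beta\mu([x,\infty))$ and $\nu^-$ is the measure on $(-\infty,-m]$ with density $|x|^\beta\mu((-\infty,x])$. Here $\beta$ and $m$ are fixed parameters, on which the constants may also depend. *)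

(* Defs.v *)
From HB Require Import structures.
From mathcomp Require Import all_boot all_order all_algebra.
From mathcomp Require Import all_classical all_reals all_analysis.
Import Order.TTheory GRing.Theory Num.Theory.
Import numFieldNormedType.Exports.

Set Implicit Arguments.
Unset Strict Implicit.
Unset Printing Implicit Defensive.

Local Open Scope classical_set_scope.
Local Open Scope ring_scope.

Section tail_conditions.
Context {R : realType}.
Implicit Types (beta m s h alpha : R) (mu : probability (measurableTypeR R) R).

(* [nu_plus beta m mu] is carried by [m, +oo[: a set A is measured through its
   trace on that half-line, and similarly for [nu_minus] on ]-oo, -m]. *)
Definition nu_plus beta m mu (A : set R) : \bar R :=
  (\int[lebesgue_measure]_(y in A `&` [set` `[m, +oo[])
     ((y `^ beta)%:E * mu [set` `[y, +oo[]))%E.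

Definition nu_minus beta m mu (A : set R) : \bar R :=
  (\int[lebesgue_measure]_(y in A `&` [set` `]-oo, (- m)%R]])
     ((`|y| `^ beta)%:E * mu [set` `]-oo, y]]))%E.

(* The second parameter [s] is the bound itself, i.e. sigma^(beta + 1). *)
Definition M_class beta m s : set (probability (measurableTypeR R) R) :=
  [set mu |
    (forall x : R, m <= x ->
      (nu_plus beta m mu [set` `[x, +oo[] <= s%:E * mu [set` `[x, +oo[])%E)
    /\
    (forall x : R, x <= - m ->
      (nu_minus beta m mu [set` `]-oo, x]] <= s%:E * mu [set` `]-oo, x]])%E)].

Definition tail_contraction beta m h alpha mu : Prop :=
  forall x : R, m < x ->
    (mu [set` `[(x + h / x `^ beta)%R, +oo[]
       <= alpha%:E * mu [set` `[x, +oo[])%E /\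
    (mu [set` `]-oo, (- x - h / x `^ beta)%R]]
       <= alpha%:E * mu [set` `]-oo, (- x)%R]])%E.

End tail_conditions.

(* Main.v *)
(* Both conditions are a pair of conditions on a nonincreasing f >= 0, taken to
   be t |-> mu [t, +oo[ or t |-> mu ]-oo, -t]; reflecting Lebesgue measure turns
   nu^- into a right-tail integral.
   (i) => (ii): the integral of y^beta f(y) over [x, x + 2s/x^beta] is at least
   2s f(x + 2s/x^beta), and by (i) at most s f(x).
   (ii) => (i): along the steps x_(n+1) = x_n + h/x_n^beta the tail f decays
   geometrically while y^beta grows by a bounded factor within one step, so the
   tail integral is dominated by a geometric series with first term O(f(x)). *)
Require Import Defs.
From HB Require Import structures.
From mathcomp Require Import all_boot all_order all_algebra.
From mathcomp Require Import all_classical all_reals all_analysis.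
From mathcomp Require Import measurable_realfun ring lra.
Import Order.TTheory GRing.Theory Num.Theory.
Import numFieldNormedType.Exports.

Local Open Scope classical_set_scope.
Local Open Scope ring_scope.

(** * Integrals of [y^beta * f y] for a nonincreasing [f] *)

Section nonincreasing_tail.
Context {R : realType}.
Variables (beta m : R).
Hypotheses (beta0 : 0 <= beta) (m0 : 0 < m).

Variable f : R -> R.
Hypotheses (f0 : forall y, 0 <= f y) (f_ni : {homo f : x y /~ x <= y}).

Definition tail_dominated (s : R) : Prop := forall x, m <= x ->
  (\int[lebesgue_measure]_(y in `[x, +oo[) (y `^ beta * f y)%:E
     <= (s * f x)%:E)%E.

Definition step_contraction (h alpha : R) : Prop := forall x, m < x ->
  f (x + h / x `^ beta) <= alpha * f x.

Lemma powR_homo (x y : R) : 0 <= x -> x <= y -> x `^ beta <= y `^ beta.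
Proof. by move=> x0 xy; apply: ge0_ler_powR; rewrite ?nnegrE//; lra. Qed.

Lemma density_ge0 (y : R) : (0 <= (y `^ beta * f y)%:E)%E.
Proof. by rewrite lee_fin mulr_ge0// powR_ge0. Qed.

Lemma measurable_density (D : set R) :
  measurable D ->
  measurable_fun D (fun y : R => (y `^ beta * f y)%:E).
Proof.
move=> mD; apply/measurable_EFinP; apply: measurable_funM.
  by apply: measurable_funTS; exact: measurable_powR.
by apply: nonincreasing_measurable => // x y xy; exact: f_ni.
Qed.

Lemma lebesgue_itvco (a b : R) : a <= b ->
  lebesgue_measure (`[a, b[ : set R) = (b - a)%:E.
Proof.
move=> ab; rewrite lebesgue_measure_itv/= lte_fin.
case: ltP => // ba; have -> : b = a by lra.
by rewrite subrr.
Qed.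

(** The two factors are monotone in opposite directions, so the constant bound takes [y^beta] at the
    left end and [f] at the right end. *)
Lemma density_integral_ge (a b : R) : 0 <= a -> a <= b ->
  (((b - a) * (a `^ beta * f b))%:E <=
   \int[lebesgue_measure]_(y in `[a, b[) (y `^ beta * f y)%:E)%E.
Proof.
move=> a0 ab; rewrite mulrC EFinM -(lebesgue_itvco _ _ ab) -integral_cst//.
apply: ge0_le_integral => //=.
- by move=> y _; rewrite lee_fin mulr_ge0// powR_ge0.
- exact: measurable_density.
- move=> y; rewrite in_itv/= => /andP[ay yb]; rewrite lee_fin.
  by rewrite ler_pM ?powR_ge0 ?powR_homo ?f_ni ?(ltW yb).
Qed.

Lemma density_integral_le (a b : R) : 0 <= a -> a <= b ->
  (\int[lebesgue_measure]_(y in `[a, b[) (y `^ beta * f y)%:E <=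
   ((b - a) * (b `^ beta * f a))%:E)%E.
Proof.
move=> a0 ab; rewrite mulrC EFinM -(lebesgue_itvco _ _ ab) -integral_cst//.
apply: ge0_le_integral => //=.
- by move=> y _; exact: density_ge0.
- exact: measurable_density.
- move=> y; rewrite in_itv/= => /andP[ay yb]; rewrite lee_fin.
  rewrite ler_pM ?powR_ge0 ?f_ni//.
  by rewrite powR_homo ?(ltW yb)// (le_trans a0).
Qed.

(** * From domination of the tail integral to step contraction *)

Lemma dominated_interval (s a b : R) : tail_dominated s -> m <= a -> a <= b ->
  (b - a) * (a `^ beta * f b) <= s * f a.
Proof.
move=> dom ma ab; rewrite -lee_fin.
apply: le_trans (dom _ ma).
have a0 : 0 <= a := le_trans (ltW m0) ma.
apply: le_trans (density_integral_ge _ _ a0 ab) _.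
apply: ge0_subset_integral => //.
- exact: measurable_density.
- by move=> y _; exact: density_ge0.
- by apply: subset_itvl.
Qed.

Lemma step_contraction_widen (h h' alpha : R) : h <= h' ->
  step_contraction h alpha -> step_contraction h' alpha.
Proof.
move=> hh' ctr x mx; apply: le_trans (ctr x mx); apply: f_ni.
by rewrite lerD2l ler_wpM2r// invr_ge0 powR_ge0.
Qed.

Lemma tail_dominated_contraction (s : R) : 0 <= s -> tail_dominated s ->
  step_contraction (2 * s) (1 / 2).
Proof.
move=> s0 dom x mx; have x0 : 0 < x := lt_trans m0 mx.
have xb0 : 0 < x `^ beta by rewrite powR_gt0.
have [s_eq0|s_neq0] := eqVneq s 0.
  (* the step is then zero, and domination from any point of ]m, x[ gives f x = 0 *)
  rewrite s_eq0 mulr0 mul0r addr0.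
  pose z := (m + x) / 2.
  have zb0 : 0 < z `^ beta by rewrite powR_gt0// divr_gt0// addr_gt0.
  have := dominated_interval _ z x dom; rewrite s_eq0 mul0r.
  have zx : 0 < x - z by rewrite /z; lra.
  have mz : m <= z by rewrite /z; lra.
  move=> /(_ mz); rewrite -subr_ge0 (ltW zx) => /(_ isT).
  rewrite pmulr_rle0// pmulr_rle0// => fx.
  by have := f0 x; lra.
have s_gt0 : 0 < s by rewrite lt_neqAle eq_sym s_neq0.
have h0 : 0 <= 2 * s / x `^ beta by rewrite divr_ge0// ?ltW//; lra.
(* The interval length times [x^beta] is [2 * s]; cancelling [s], nonzero here, leaves
   [2 * f (x + 2 * s / x^beta) <= f x]. *)
have := dominated_interval _ x (x + 2 * s / x `^ beta) dom.
rewrite lerDl (ltW mx) h0 => /(_ isT isT).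
rewrite addrAC subrr add0r mulrA divfK ?gt_eqF// -mulrA mulrCA ler_pM2l//.
by lra.
Qed.

(** * From step contraction to domination of the tail integral *)

Lemma density_integral_split (a b c : R) :
  (\int[lebesgue_measure]_(y in `[a, c[) (y `^ beta * f y)%:E <=
   \int[lebesgue_measure]_(y in `[a, b[) (y `^ beta * f y)%:E +
   \int[lebesgue_measure]_(y in `[b, c[) (y `^ beta * f y)%:E)%E.
Proof.
rewrite -ge0_integral_setU//; last first.
- rewrite disj_set2E; apply/eqP/seteqP; split => // y [] /=.
  by rewrite !in_itv/= => /andP[_ yb] /andP[by_ _]; lra.
- by move=> y _; exact: density_ge0.
- by apply: measurable_density; exact: measurableU.
(* An inclusion suffices and needs no order on [a], [b], [c]: the last step of an iteration may
   overshoot the right end. *)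
apply: ge0_subset_integral => //.
- exact: measurableU.
- by apply: measurable_density; exact: measurableU.
- by move=> y _; exact: density_ge0.
- move=> y /=; rewrite !in_itv/= => /andP[ay yc].
  by have [yb|by_] := ltP y b; [left|right]; apply/andP.
Qed.

(** Monotone convergence along the increasing intervals [[a, a + i[], whose union is the
    half-line. *)
Lemma density_integral_lim (a K : R) :
  (forall b, (\int[lebesgue_measure]_(y in `[a, b[) (y `^ beta * f y)%:E
     <= K%:E)%E) ->
  (\int[lebesgue_measure]_(y in `[a, +oo[) (y `^ beta * f y)%:E <= K%:E)%E.
Proof.
move=> le_K; rewrite (itv_bndy_bigcup_BLeft_shift _ _ 0).
apply: cvge_le; last first.
  apply: ge0_nondecreasing_set_cvg_integral => //.
  - move=> i j ij; rewrite subsetEset; apply: subset_itvl.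
    by rewrite bnd_simp lerD2l ler_nat leq_add2r.
  - by move=> i; exact: measurable_density.
  - by move=> i y _; exact: density_ge0.
by apply: nearW => i; exact: le_K.
exact: eventually_filter.
Qed.

(** Bounds the growth factor of [y^beta] over one step, uniformly over starting points [x >= m]. *)
Let C (h : R) := (1 + h / (m * m `^ beta)) `^ beta.

(** The first term pays for [[m, m + 1[], needed when the integral starts at [m], where contraction
    is not assumed. The second is the sum of the geometric series with first term [h * C h] and
    ratio [Num.max alpha 0]; the maximum is there because [alpha] may be negative. *)
Definition dominating_constant (h alpha : R) : R :=
  (m + 1) `^ beta + h * C h / (1 - Num.max alpha 0).

Lemma dominating_constant_ge0 (h alpha : R) : 0 <= h -> alpha < 1 ->
  0 <= dominating_constant h alpha.
Proof.
move=> h0 a1; rewrite addr_ge0 ?powR_ge0// divr_ge0//.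
  by rewrite mulr_ge0// powR_ge0.
by rewrite subr_ge0 ge_max (ltW a1) ler01.
Qed.

(** Since [x * x^beta >= m * m^beta], the step [h / x^beta] is at most [x * (h / (m * m^beta))];
    then [x] factors out of the sum. *)
Lemma step_powR_le (h x : R) : 0 <= h -> m <= x ->
  (x + h / x `^ beta) `^ beta <= x `^ beta * C h.
Proof.
move=> h0 mx; have x0 : 0 < x := lt_le_trans m0 mx.
have xb0 : 0 < x `^ beta by rewrite powR_gt0.
have mb0 : 0 < m `^ beta by rewrite powR_gt0.
have c0 : 0 <= h / (m * m `^ beta) by rewrite divr_ge0// mulr_ge0// ltW.
have ? : 0 <= h / x `^ beta by rewrite divr_ge0// ltW.
rewrite -powRM; [|lra|lra].
apply: powR_homo; first by lra.
rewrite mulrDr mulr1 lerD2l.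
have -> : x * (h / (m * m `^ beta)) =
    h / x `^ beta * (x * x `^ beta / (m * m `^ beta)).
  by field; rewrite !gt_eqF.
rewrite ler_peMr// ler_pdivlMr ?mulr_gt0// mul1r.
by rewrite ler_pM ?powR_homo// ltW.
Qed.

(* One step from [x] to [x1 = x + h / x^beta] costs at most [h C f x], and the
   remainder at most [K f x1 <= a K f x]; the constant [K] solves
   [h C + a K = K]. *)
Lemma contraction_integral_le (h alpha x b : R) : 0 < h -> alpha < 1 ->
  step_contraction h alpha -> m < x ->
  (\int[lebesgue_measure]_(y in `[x, b[) (y `^ beta * f y)%:E
     <= (h * C h / (1 - Num.max alpha 0) * f x)%:E)%E.
Proof.
move=> h0 alpha1 ctr.
set a := Num.max alpha 0; set K := h * C h / (1 - a).
have a1 : a < 1 by rewrite gt_max alpha1 ltr01.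
have a0 : 0 <= a by rewrite le_max lexx orbT.
have K0 : 0 <= K by rewrite divr_ge0 ?mulr_ge0 ?powR_ge0//; lra.
have Kfix : h * C h + a * K = K by rewrite /K; field; rewrite subr_eq0 gt_eqF.
clearbody K.
(* Every step starting in []m, b[] has length at least [d], so finitely many steps reach [b]. The
   maximum with [m] keeps the base positive for every [b]. *)
pose d := h / (Num.max m b) `^ beta.
have d0 : 0 < d by rewrite divr_gt0// powR_gt0// lt_max m0.
have [n] : exists n : nat, b <= m + n%:R * d.
  exists (Num.bound (`|b| / d)).
  have := archi_boundP (divr_ge0 (normr_ge0 b) (ltW d0)).
  rewrite ltr_pdivrMr// => nd.
  by have := ler_norm b; have m_gt0 := m0; lra.
move=> bn mx.
have {bn} : b <= x + n%:R * d by lra.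
(* Induction on a number of steps sufficient to reach [b]; with none left, [[x, b[] is empty. *)
elim: n x mx => [|n IH] x mx bn.
  rewrite set_itv_ge; last by rewrite bnd_simp; lra.
  by rewrite integral_set0 lee_fin mulr_ge0.
have x0 : 0 < x := lt_trans m0 mx.
have [bx|xb] := leP b x.
  rewrite set_itv_ge; last by rewrite bnd_simp; lra.
  by rewrite integral_set0 lee_fin mulr_ge0.
have xb0 : 0 < x `^ beta by rewrite powR_gt0.
pose x1 := x + h / x `^ beta.
have dx : d <= h / x `^ beta.
  rewrite ler_pM2l// lef_pV2 ?posrE//; last by rewrite powR_gt0// lt_max m0.
  by apply: powR_homo; [lra|rewrite le_max (ltW xb) orbT].
have xx1 : x <= x1 by rewrite /x1; lra.
apply: le_trans (density_integral_split x x1 b) _.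
have mx1 : m < x1 by lra.
have bx1 : b <= x1 + n%:R * d.
  by move: bn; rewrite -natr1 mulrDl mul1r /x1; lra.
apply: le_trans (leeD (density_integral_le x x1 (ltW x0) xx1) (IH x1 mx1 bx1)) _.
rewrite -EFinD lee_fin.
have -> : K * f x = h * C h * f x + a * K * f x by rewrite -mulrDl Kfix.
rewrite lerD//.
  (* Cost of the step: [h / x^beta * x1^beta <= h * C h]. *)
  rewrite mulrA ler_wpM2r// /x1 addrAC subrr add0r -/x1.
  rewrite -mulrA ler_pM2l// mulrC ler_pdivrMr// mulrC.
  by apply: step_powR_le; lra.
rewrite (mulrC a) -mulrA ler_wpM2l//; apply: le_trans (ctr x mx) _.
by rewrite ler_wpM2r// le_max lexx.
Qed.

Lemma contraction_tail_dominated (h alpha : R) : 0 < h -> alpha < 1 ->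
  step_contraction h alpha -> tail_dominated (dominating_constant h alpha).
Proof.
move=> h0 alpha1 ctr x mx; apply: density_integral_lim => b.
have pos := powR_ge0 (m + 1) beta.
have [mx'|xm] := ltP m x.
  apply: le_trans (contraction_integral_le h alpha x b _ _ ctr _) _ => //.
  by rewrite lee_fin ler_wpM2r// lerDr.
(* At [m] itself the integral over [[m, m + 1[] is bounded directly, and the contraction is used
   only from [m + 1] on, with [f (m + 1) <= f m]. *)
have {mx xm} -> : x = m by lra.
apply: le_trans (density_integral_split m (m + 1) b) _.
have mm1 : m < m + 1 by lra.
apply: le_trans (leeD (density_integral_le m (m + 1) (ltW m0) (ltW mm1))
  (contraction_integral_le h alpha (m + 1) b h0 alpha1 ctr mm1)) _.
rewrite -EFinD lee_fin (_ : m + 1 - m = 1) ?mul1r; last by ring.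
rewrite /dominating_constant [leRHS]mulrDl lerD2l.
apply: ler_wpM2l; last by rewrite f_ni// ltW.
rewrite divr_ge0 ?mulr_ge0 ?powR_ge0 ?(ltW h0)//.
by rewrite subr_ge0 ltW// gt_max alpha1 ltr01.
Qed.

End nonincreasing_tail.

(** * Transfer to the two tails of a probability measure *)

Section probability_tails.
Context {R : realType}.
Variable mu : probability (measurableTypeR R) R.

Definition right_tail (y : R) : R := fine (mu [set` `[y, +oo[]).
Definition left_tail (y : R) : R := fine (mu [set` `]-oo, (- y)%R]]).

Lemma right_tailE (y : R) : mu [set` `[y, +oo[] = (right_tail y)%:E.
Proof. by rewrite fineK// fin_num_measure. Qed.

Lemma left_tailE (y : R) : mu [set` `]-oo, y]] = (left_tail (- y))%:E.
Proof. by rewrite /left_tail opprK fineK// fin_num_measure. Qed.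

Lemma right_tail_ge0 (y : R) : 0 <= right_tail y.
Proof. exact: fine_ge0. Qed.

Lemma left_tail_ge0 (y : R) : 0 <= left_tail y.
Proof. exact: fine_ge0. Qed.

Lemma right_tail_ni : {homo right_tail : x y /~ x <= y}.
Proof.
move=> x y xy; rewrite -lee_fin -!right_tailE le_measure ?inE//.
by apply: subset_itvr; rewrite bnd_simp.
Qed.

Lemma left_tail_ni : {homo left_tail : x y /~ x <= y}.
Proof.
move=> x y xy; rewrite -lee_fin -[x]opprK -[y]opprK -!left_tailE.
rewrite le_measure ?inE//.
by apply: subset_itvl; rewrite bnd_simp lerN2.
Qed.

Lemma nu_plusE (beta m x : R) : m <= x ->
  nu_plus beta m mu [set` `[x, +oo[] =
  (\int[lebesgue_measure]_(y in `[x, +oo[) (y `^ beta * right_tail y)%:E)%E.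
Proof.
move=> mx; rewrite /nu_plus setIidl; last first.
  by apply: subset_itvr; rewrite bnd_simp.
by apply: eq_integral => y _; rewrite right_tailE.
Qed.

(** Substitution of [-y] for [y]: Lebesgue measure is invariant under negation, and the absolute
    value of [y] is [-y] because [y <= -x < 0] on the domain. *)
Lemma nu_minusE (beta m x : R) : 0 < m -> m <= x ->
  nu_minus beta m mu [set` `]-oo, (- x)%R]] =
  (\int[lebesgue_measure]_(y in `[x, +oo[) (y `^ beta * left_tail y)%:E)%E.
Proof.
move=> m0 mx; rewrite /nu_minus setIidl; last first.
  by apply: subset_itvl; rewrite bnd_simp lerN2.
pose g (y : R) := (y `^ beta * left_tail y)%:E.
transitivity (\int[lebesgue_measure]_(y in `]-oo, (- x)%R]) (g \o -%R) y)%E.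
  apply: eq_integral => y; rewrite inE/= in_itv/= => yx.
  by rewrite left_tailE /g -EFinM ler0_norm//; lra.
rewrite (_ : `]-oo, (- x)%R]%classic =
    (-%R : _ -> measurableTypeR R) @^-1` `[x, +oo[); last first.
  by rewrite opp_preimage_itvbndy.
rewrite -ge0_integral_pushforward//=.
- by apply: eq_measure_integral => //= A mA _; exact: lebesgue_measureN.
- by apply: measurable_density => //; exact: left_tail_ni.
- by move=> y _; rewrite lee_fin mulr_ge0 ?powR_ge0 ?left_tail_ge0.
Qed.

Lemma M_classP (beta m s : R) : 0 < m -> M_class beta m s mu <->
  tail_dominated beta m right_tail s /\ tail_dominated beta m left_tail s.
Proof.
move=> m0; split=> [[Mr Ml]|[Mr Ml]]; split=> x mx.
- by rewrite -(nu_plusE beta m)// EFinM -right_tailE; exact: Mr.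
- rewrite -(nu_minusE beta m)// EFinM -[x in left_tail x]opprK -left_tailE.
  by apply: Ml; rewrite lerN2.
- by rewrite (nu_plusE beta m)// right_tailE -EFinM; exact: Mr.
- rewrite -[x]opprK (nu_minusE beta m)//; last by lra.
  by rewrite left_tailE opprK -EFinM; apply: Ml; lra.
Qed.

Lemma tail_contractionP (beta m h alpha : R) :
  tail_contraction beta m h alpha mu <->
  step_contraction beta m right_tail h alpha /\
  step_contraction beta m left_tail h alpha.
Proof.
split=> [ctr|[cr cl] x mx].
  split=> x /ctr[].
    by rewrite !right_tailE -EFinM lee_fin.
  by rewrite !left_tailE -EFinM lee_fin opprB opprK addrC.
rewrite !right_tailE !left_tailE -!EFinM !lee_fin opprB !opprK.
by split; [exact: cr|rewrite addrC; exact: cl].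
Qed.

Lemma M_class_contraction (beta m s : R) : 0 <= beta -> 0 < m -> 0 <= s ->
  M_class beta m s mu -> tail_contraction beta m (2 * s) (1 / 2) mu.
Proof.
move=> beta0 m0 s0 /(M_classP _ _ _ m0)[dr dl].
apply/tail_contractionP; split; apply: tail_dominated_contraction => //.
- exact: right_tail_ge0.
- exact: right_tail_ni.
- exact: left_tail_ge0.
- exact: left_tail_ni.
Qed.

(** The constant is built from [beta], [m], [h] and [alpha] alone, hence is uniform in [mu]. *)
Lemma contraction_M_class (beta m h alpha : R) : 0 <= beta -> 0 < m ->
  0 < h -> alpha < 1 -> tail_contraction beta m h alpha mu ->
  M_class beta m (dominating_constant beta m h alpha) mu.
Proof.
move=> beta0 m0 h0 alpha1 /tail_contractionP[cr cl].
apply/M_classP => //; split; apply: contraction_tail_dominated => //.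
- exact: right_tail_ge0.
- exact: right_tail_ni.
- exact: left_tail_ge0.
- exact: left_tail_ni.
Qed.

Lemma tail_contraction_widen (beta m h h' alpha : R) : h <= h' ->
  tail_contraction beta m h alpha mu -> tail_contraction beta m h' alpha mu.
Proof.
move=> hh' /tail_contractionP[cr cl]; apply/tail_contractionP.
split; apply: step_contraction_widen hh' _ => //.
- exact: right_tail_ni.
- exact: left_tail_ni.
Qed.

End probability_tails.

(** * The equivalence, with constants uniform in [mu] *)

Theorem proposition1p2 (R : realType) (beta m : R)
    (hbeta : 0 <= beta <= 1) (hm : 0 < m) :
  [/\ (* (i) <-> (ii) *)
      forall mu : probability (measurableTypeR R) R,
        (exists sigma : R,
           0 <= sigma /\ M_class beta m (sigma `^ (beta + 1)) mu) <->
        (exists h alpha : R,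
           [/\ 0 < h, alpha < 1 & tail_contraction beta m h alpha mu]),
      (* the constant in (i) depends only on those in (ii) *)
      forall h alpha : R, 0 < h -> alpha < 1 ->
        exists sigma : R, 0 <= sigma /\
          forall mu : probability (measurableTypeR R) R,
            tail_contraction beta m h alpha mu ->
            M_class beta m (sigma `^ (beta + 1)) mu,
      (* the constants in (ii) depend only on the one in (i) *)
      forall sigma : R, 0 <= sigma ->
        exists h alpha : R, [/\ 0 < h, alpha < 1 &
          forall mu : probability (measurableTypeR R) R,
            M_class beta m (sigma `^ (beta + 1)) mu ->
            tail_contraction beta m h alpha mu]
    & (* explicit choice of h and alpha *)
      forall sigma : R, 0 <= sigma ->
        forall mu : probability (measurableTypeR R) R,
          M_class beta m (sigma `^ (beta + 1)) mu ->
          tail_contraction beta m (2 * sigma `^ (beta + 1)) (1 / 2) mu].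
Proof.
have /andP[beta0 _] := hbeta.
have to_i : forall h alpha : R, 0 < h -> alpha < 1 -> exists sigma : R,
    0 <= sigma /\ forall mu : probability (measurableTypeR R) R,
    tail_contraction beta m h alpha mu ->
    M_class beta m (sigma `^ (beta + 1)) mu.
  move=> h alpha h0 alpha1; pose K := dominating_constant beta m h alpha.
  (* Chosen so that [sigma^(beta + 1) = K], which uses [K >= 0]. *)
  exists (K `^ (beta + 1)^-1); split; first exact: powR_ge0.
  move=> mu ctr; rewrite -powRrM mulVf ?gt_eqF//; last by lra.
  rewrite powRr1; first exact: contraction_M_class.
  by apply: dominating_constant_ge0 => //; exact: ltW.
have explicit : forall sigma : R, 0 <= sigma ->
    forall mu : probability (measurableTypeR R) R,
    M_class beta m (sigma `^ (beta + 1)) mu ->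
    tail_contraction beta m (2 * sigma `^ (beta + 1)) (1 / 2) mu.
  by move=> sigma _ mu; apply: M_class_contraction => //; exact: powR_ge0.
have to_ii : forall sigma : R, 0 <= sigma ->
    exists h alpha : R, [/\ 0 < h, alpha < 1 &
    forall mu : probability (measurableTypeR R) R,
    M_class beta m (sigma `^ (beta + 1)) mu ->
    tail_contraction beta m h alpha mu].
  (* The explicit [h] vanishes when [sigma = 0]; adding [1] makes it positive, and a longer step
     preserves the contraction. *)
  move=> sigma s0; exists (2 * sigma `^ (beta + 1) + 1), (1 / 2).
  have := powR_ge0 sigma (beta + 1) => ?; split; [lra|lra|move=> mu /explicit].
  by move=> /(_ s0); apply: tail_contraction_widen; lra.
split=> // mu; split.
- move=> [sigma [s0 Mmu]]; have [h [alpha [h0 alpha1 ctr]]] := to_ii sigma s0.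
  by exists h, alpha; split=> //; exact: ctr.
- move=> [h [alpha [h0 alpha1 ctr]]].
  have [sigma [s0 Mmu]] := to_i h alpha h0 alpha1.
  by exists sigma; split=> //; exact: Mmu.
Qed.
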